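(* Let $K\in\mathbb{R}^{d\times m}$ be a stabilizing gain (for the linear time-invariant state-feedback controller $u_t=-Kx_t$) such that the Riccati equation $$P_K=Q+K^\top RK+(A-BK)^\top\Big[P_K-P_K\big(-\tfrac1\beta W^{-1}+P_K\big)^{-1}P_K\Big](A-BK)$$ admits a solution $P_K\ge0$ that (i) is stabilizing, i.e., $\rho\big((A-BK)^\top(I-\beta P_KW)^{-1}\big)<1$, and (ii) satisfies $W^{-1}-\beta P_K>0$. Then $$\mathcal{J}(K)=-\frac1\beta\log\det(I-\beta P_KW).$$
   Context: Setting (infinite-horizon state-feedback linear exponential quadratic Gaussian, LEQG, problem). The state $x_t\in\mathbb{R}^m$ and control $u_t\in\mathbb{R}^d$ follow $x_{t+1}=Ax_t+Bu_t+w_t$ for $t\ge0$, with $A,B$ real matrices of proper dimensions, $x_0\sim\mathcal{N}(0,X_0)$, $w_t\sim\mathcal{N}(0,W)$ all independent, and $X_0,W$ positive definite. The one-stage cost is $c(x,u)=x^\top Qx+u^\top Ru$ with $Q,R$ positive definite. $\beta>0$ is the risk-sensitivity parameter. For a gain $K$ with $u_t=-Kx_t$, $$\mathcal{J}(K):=\lim_{T\to\infty}\frac1T\frac2\beta\log\mathbb{E}\exp\Big[\frac\beta2\sum_{t=0}^{T-1}c(x_t,-Kx_t)\Big].$$ $K$ is stabilizing if $\rho(A-BK)<1$; $\rho(\cdot)$ is the spectral radius; $X>0$ ($X\ge0$) denotes (symmetric) positive definite (semidefinite).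
   Formalization: The formal theorem adds the hypothesis X_0^{-1} − βP_K > 0; without it the claim fails (e.g. A=B=K=0, β=W=1, Q=1/2, X_0≥2 gives J(K)=+∞ instead of log 2). *)

(* Defs.v *)
From HB Require Import structures.
From mathcomp Require Import all_boot all_order all_algebra.
From mathcomp Require Import finmap.
From mathcomp Require Import all_classical all_reals all_analysis.
From mathcomp Require Import complex.

Set Implicit Arguments.
Unset Strict Implicit.
Unset Printing Implicit Defensive.

Import Order.TTheory GRing.Theory Num.Theory.
Import numFieldTopology.Exports numFieldNormedType.Exports.

Local Open Scope classical_set_scope.
Local Open Scope ring_scope.

Section Matrices.
Context {R : realType}.

Definition quad {n : nat} (M : 'M[R]_n) (v : 'cV[R]_n) : R :=
  (v^T *m M *m v) 0 0.

Definition posdefmx {n : nat} (M : 'M[R]_n) : Prop :=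
  M^T = M /\ forall v : 'cV[R]_n, v != 0 -> 0 < quad M v.

Definition possemidefmx {n : nat} (M : 'M[R]_n) : Prop :=
  M^T = M /\ forall v : 'cV[R]_n, 0 <= quad M v.

(* The set of eigenvalue moduli is finite, and nonempty when 0 < n, so the
   supremum is a maximum; for n = 0 it is sup set0 = 0. *)
Definition spectral_radius {n : nat} (M : 'M[R]_n) : R :=
  sup [set ComplexField.Normc.normc z | z in
        [set z : complex R |
          eigenvalue (map_mx (real_complex R) M) z]].

End Matrices.

Section RandomVectors.
Context {disp : measure_display} {T : measurableType disp} {R : realType}.
Variable P : probability T R.

Definition borel_vec (n : nat) := g_sigma_algebraType (@open 'cV[R]_n).

Definition random_vector {n : nat} (X : T -> 'cV[R]_n) : Prop :=
  measurable_fun [set: T] (X : T -> borel_vec n).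

(* The centred normal law on R with variance v >= 0. The case v = 0 is
   separate because normal_prob 0 0 is not a point mass: normal_pdf with
   deviation 0 is the density of the uniform law on [0, 1]. *)
Definition centered_normal (v : R) (A : set R) : \bar R :=
  if v == 0 then \d_(0 : R) A else normal_prob 0 (Num.sqrt v) A.

(* X ~ N(0, S): every linear form u^T X has the law N(0, u^T S u). *)
Definition gaussian_vector {n : nat} (X : T -> 'cV[R]_n) (S : 'M[R]_n) : Prop :=
  random_vector X /\
  forall (u : 'cV[R]_n) (A : set R), measurable A ->
    P [set o | A ((u^T *m X o) 0 0)] = centered_normal (quad S u) A.

Definition mutually_independent {I : choiceType} {n : nat}
    (X : I -> T -> 'cV[R]_n) : Prop :=
  forall (J : {fset I}) (B : I -> set (borel_vec n)),
    (forall i, i \in J -> measurable (B i)) ->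
    P (\bigcap_(i in [set` J]) (X i @^-1` B i)) =
    (\prod_(i <- J) P (X i @^-1` B i))%E.

End RandomVectors.

Section LEQG.
Context {disp : measure_display} {T : measurableType disp} {R : realType}.
Context {m d : nat}.

Definition noise_family (x0 : T -> 'cV[R]_m) (w : nat -> T -> 'cV[R]_m)
    (t : nat) : T -> 'cV[R]_m :=
  if t is s.+1 then w s else x0.

Fixpoint state (A : 'M[R]_m) (B : 'M[R]_(m, d)) (K : 'M[R]_(d, m))
    (x0 : T -> 'cV[R]_m) (w : nat -> T -> 'cV[R]_m) (t : nat) (o : T) :
    'cV[R]_m :=
  if t is s.+1 then
    let x := state A B K x0 w s o in
    let u := - (K *m x) in
    A *m x + B *m u + w s o
  else x0 o.

Definition stage_cost (Q : 'M[R]_m) (Rc : 'M[R]_d) (x : 'cV[R]_m)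
    (u : 'cV[R]_d) : R :=
  quad Q x + quad Rc u.

Variable P : probability T R.

(* The expectation is taken in \bar R (it may be +oo), with lne +oo = +oo. *)
Definition finite_horizon_cost (A : 'M[R]_m) (B : 'M[R]_(m, d)) (Q : 'M[R]_m)
    (Rc : 'M[R]_d) (beta : R) (x0 : T -> 'cV[R]_m) (w : nat -> T -> 'cV[R]_m)
    (K : 'M[R]_(d, m)) (N : nat) : \bar R :=
  ((N%:R^-1 * (2 / beta))%:E *
   lne 'E_P[fun o => expR (beta / 2 * \sum_(t < N)
     let x := state A B K x0 w t o in stage_cost Q Rc x (- (K *m x)))])%E.

(* Meaningful only together with the convergence of the sequence. *)
Definition leqg_cost (A : 'M[R]_m) (B : 'M[R]_(m, d)) (Q : 'M[R]_m)
    (Rc : 'M[R]_d) (beta : R) (x0 : T -> 'cV[R]_m) (w : nat -> T -> 'cV[R]_m)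
    (K : 'M[R]_(d, m)) : \bar R :=
  limn (finite_horizon_cost A B Q Rc beta x0 w K).

Definition riccati_equation (A : 'M[R]_m) (B : 'M[R]_(m, d)) (Q : 'M[R]_m)
    (Rc : 'M[R]_d) (W : 'M[R]_m) (beta : R) (K : 'M[R]_(d, m))
    (PK : 'M[R]_m) : Prop :=
  PK = Q + K^T *m Rc *m K
     + (A - B *m K)^T
       *m (PK - PK *m invmx (- (beta^-1 *: invmx W) + PK) *m PK)
       *m (A - B *m K).

End LEQG.

(* Main.v *)
Require Import Defs.
From mathcomp Require Import all_boot all_order all_algebra.
From mathcomp Require Import perm finmap.
From mathcomp Require Import all_classical all_reals all_analysis.
From mathcomp Require Import measurable_realfun measurable_fun_approximation complex.
From mathcomp Require Import ring.

(** Put [p = beta PK], [mu = beta (Q + K^T Rc K)], [F = A - B K]. The theorem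
    follows from a closed form for the exponential moment
    [E exp (1/2 sum_(t < N) x_t^T mu x_t)].

    Only the laws of the linear forms of the noise are known, and they give the
    joint moment generating function of the family [x0, w 0, w 1, ...]
    ([gaussian_mgf], [independent_integral_prod]). That is enough. Say that a
    weight [Z] is Gaussian along [x] with precision [Y] when
    [E (Z exp (u^T x))] is a multiple of [exp (u^T Y^-1 u / 2)] for every [u].
    Since [exp (z^2 / 2)] is the mean of [exp (g z)] over a standard normal
    [g], Tonelli's theorem shows that multiplying [Z] by [exp ((f^T x)^2 / 2)]
    keeps this property and turns [Y] into [Y - f f^T]; a positive semidefinite
    [V] being a sum of rank one terms, multiplying [Z] by
    [exp (x^T V x / 2)] turns [Y] into [Y - V] ([gaussian_weighted_tilt]).
    Passing from [x t] to [x t.+1 = F x t + w t] adds the independent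
    covariance [W].

    These two moves produce a nonlinear recursion for the precision [Y k] of
    [x k]. The Riccati equation linearizes it: [Y k = S k^-1 + p], where
    [S k.+1 = G S k G^T + (W^-1 - p)^-1] and [G = (1 - W p)^-1 F]
    ([precision_step]). The matrix [S k] is the covariance of the state under
    the law reweighted by the risk-sensitive value function. The determinants
    telescope ([det_precision_step]) and the moment equals the square root of
    [kappa / (det (1 - p W))^N / det (1 + S N p)]
    ([expectation_quadratic]), with [kappa] independent of [N].

    Finally [G^T] is the matrix that the stabilizing hypothesis speaks of, so
    its powers are summable ([spectral_radius_lt1_bounded_sum]: the
    Cayley-Hamilton theorem reduces this to first-order recurrences with
    ratios of modulus less than 1). Hence [S N] is bounded, the last
    determinant stays between 1 and a constant, and after taking logarithms and
    dividing by [N] only [det (1 - p W)] survives. *)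

Set Implicit Arguments.
Unset Strict Implicit.
Unset Printing Implicit Defensive.

Import Order.TTheory GRing.Theory Num.Theory.
Import numFieldTopology.Exports numFieldNormedType.Exports.

Local Open Scope classical_set_scope.
Local Open Scope ring_scope.

(** * Layer-cake formula *)

Section LayerCake.
Context {R : realType}.
Local Notation leb := (@lebesgue_measure R).

Lemma measurable_setltr {d} {T : measurableType d} (f g : T -> R) :
  measurable_fun setT f -> measurable_fun setT g ->
  measurable [set o | f o < g o].
Proof.
move=> mf mg; rewrite -[X in measurable X]setTI.
exact: (measurable_fun_ltr mf mg measurableT (Y := [set true])).
Qed.

Lemma layer_slice (c : R) : 0 <= c ->
  (\int[leb]_s (\1_[set s | 0 < s < c] s)%:E = c%:E)%E.
Proof.
move=> c0; have -> : [set s | 0 < s < c] = `]0, c[%classic.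
  by apply/seteqP; split => x /=; rewrite in_itv/=.
rewrite integral_indic// setIT/= lebesgue_measure_itv/= lte_fin; case: ltP => c0'.
  by rewrite oppr0 adde0.
by congr EFin; apply/eqP; rewrite eq_le c0 c0'.
Qed.

(** Write Y o as the length of the interval between 0 and Y o and exchange
    the integrals. *)
Lemma layer_cake {d} {T : measurableType d}
    (mu : {sigma_finite_measure set T -> \bar R}) (Z Y : T -> R) :
  measurable_fun setT Z -> measurable_fun setT Y ->
  (forall o, 0 <= Z o) -> (forall o, 0 <= Y o) ->
  (\int[mu]_o (Z o * Y o)%:E =
   \int[leb]_s \int[mu]_o (Z o * \1_[set s | 0 < s < Y o] s)%:E)%E.
Proof.
move=> mZ mY Z0 Y0.
pose f (q : T * R) : \bar R := (Z q.1 * \1_[set s | 0 < s < Y q.1] q.2)%:E.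
have mf : measurable_fun setT f.
  apply/measurable_EFinP; apply: measurable_funM.
    exact: measurableT_comp.
  rewrite [X in measurable_fun _ X](_ : _ =
     (\1_[set q : T * R | 0 < q.2 < Y q.1] : T * R -> R)); last first.
    by apply/funext => -[t s] /=; rewrite !indicE.
  apply: measurable_indic.
  rewrite [X in measurable X](_ : _ =
     [set q : T * R | 0 < q.2] `&` [set q : T * R | q.2 < Y q.1]); last first.
    by apply/seteqP; split => x /= /andP.
  apply: measurableI; apply: measurable_setltr => //.
  exact: measurableT_comp.
have f0 q : (0 <= f q)%E by rewrite lee_fin mulr_ge0// indicE.
have <- := fubini_tonelli (m1 := mu) (m2 := leb) f mf f0.
apply: eq_integral => o _.
under eq_integral do rewrite /f/= EFinM.
rewrite ge0_integralZl//; last 2 first.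
- by apply/measurable_EFinP; apply: measurable_indic;
    rewrite [X in measurable X](_ : _ = `]0, Y o[%classic).
- by rewrite lee_fin.
by rewrite layer_slice.
Qed.

End LayerCake.

(** * One-dimensional Gaussian integrals and comparison of integrals by layers *)

Section Gauss1D.
Context {R : realType}.
Local Notation leb := (@lebesgue_measure R).

(** Completing the square turns the integrand into a multiple of the normal
    density with variance s^2 / (1 - b s^2) and mean a s^2 / (1 - b s^2). *)
Lemma integral_expR_quadratic_normal_pdf (a b s : R) : 0 < s -> b * s ^+ 2 < 1 ->
  (\int[leb]_x (normal_pdf 0 s x * expR (a * x + b * x ^+ 2 / 2))%:E
   = ((Num.sqrt (1 - b * s ^+ 2))^-1 *
      expR (a ^+ 2 * s ^+ 2 / (1 - b * s ^+ 2) / 2))%:E)%E.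
Proof.
move=> s0 bs; set k := 1 - b * s ^+ 2.
have k0 : 0 < k by rewrite subr_gt0.
pose q := Num.sqrt k; have q0 : 0 < q by rewrite sqrtr_gt0.
have qk : q ^+ 2 = k by rewrite sqr_sqrtr// ltW.
pose t := s / q; pose mm := a * s ^+ 2 / k.
have t0 : 0 < t by rewrite divr_gt0.
pose C := q^-1 * expR (a ^+ 2 * s ^+ 2 / k / 2).
transitivity (\int[leb]_x (C%:E * (normal_pdf mm t x)%:E))%E.
  apply: eq_integral => x _; rewrite -EFinM; congr EFin.
  rewrite !normal_pdfE ?gt_eqF// /C /normal_fun /normal_peak.
  have -> : Num.sqrt (t ^+ 2 * pi *+ 2) = Num.sqrt (s ^+ 2 * pi *+ 2) / q.
    have -> : t ^+ 2 * pi *+ 2 = (s ^+ 2 * pi *+ 2) * (q^-1) ^+ 2.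
      by rewrite /t; field; rewrite gt_eqF.
    rewrite sqrtrM; last by rewrite mulrn_wge0// mulr_ge0 ?sqr_ge0// pi_ge0.
    by rewrite sqrtr_sqr ger0_norm// invr_ge0 ltW.
  set e1 := expR _; set e2 := expR _; set e3 := expR _; set e4 := expR _.
  have e12 : e1 * e2 = e3 * e4.
    rewrite -!expRD; congr expR.
    rewrite /t /mm exprMn exprVn qk /k; field.
    by rewrite -/k !gt_eqF.
  rewrite invf_div -mulrA e12 -/q; set A := (Num.sqrt (_ *+ 2))^-1.
  by field; rewrite gt_eqF.
rewrite ge0_integralZl//.
- by rewrite integral_normal_pdf mule1.
- by apply/measurable_EFinP; exact: measurable_normal_pdf.
- by move=> x _; rewrite lee_fin normal_pdf_ge0.
- by rewrite lee_fin mulr_ge0 ?expR_ge0// invr_ge0 ltW.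
Qed.

End Gauss1D.

Section LayerTransfer.
Context {R : realType}.
Local Open Scope ereal_scope.

(** Serves twice: with a law on the right, to integrate against a random
    variable whose law is known; with a random variable that is replaced by
    one of its rays, to integrate products of independent variables without
    constructing a product measure. *)
Lemma eq_integral_layers {d1 d2} {T1 : measurableType d1}
    {T2 : measurableType d2}
    (m1 : {sigma_finite_measure set T1 -> \bar R})
    (m2 : {sigma_finite_measure set T2 -> \bar R})
    (Z1 Y1 : T1 -> R) (Z2 Y2 : T2 -> R) (a : R) :
  measurable_fun setT Z1 -> measurable_fun setT Y1 ->
  measurable_fun setT Z2 -> measurable_fun setT Y2 ->
  (forall o, 0 <= Z1 o)%R -> (forall o, 0 <= Y1 o)%R ->
  (forall o, 0 <= Z2 o)%R -> (forall o, 0 <= Y2 o)%R -> (0 <= a)%R ->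
  (forall s : R, (0 < s)%R ->
     \int[m1]_x (Z1 x * \1_[set y | s < Y1 y]%R x)%:E =
     a%:E * \int[m2]_x (Z2 x * \1_[set y | s < Y2 y]%R x)%:E) ->
  \int[m1]_x (Z1 x * Y1 x)%:E = a%:E * \int[m2]_x (Z2 x * Y2 x)%:E.
Proof.
move=> mZ1 mY1 mZ2 mY2 Z10 Y10 Z20 Y20 a0 h.
pose aZ2 x := (a * Z2 x)%R.
have maZ2 : measurable_fun setT aZ2 by exact: measurable_funM.
have aZ20 x : (0 <= aZ2 x)%R by rewrite mulr_ge0.
have -> : a%:E * \int[m2]_x (Z2 x * Y2 x)%:E = \int[m2]_x (aZ2 x * Y2 x)%:E.
  rewrite -ge0_integralZl//.
  - by apply: eq_integral => x _; rewrite -EFinM mulrA.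
  - by apply/measurable_EFinP; exact: measurable_funM.
  - by move=> x _; rewrite lee_fin mulr_ge0.
rewrite !layer_cake//; apply: eq_integral => s _.
have sl (A : Type) (Y : A -> R) x :
    \1_[set s | (0 < s < Y x)%R] s = (\1_[set y | s < Y y] x * (0 < s)%R%:R)%R :> R.
  have inE' (B : Type) (P : pred B) y : (y \in [set y | P y]) = P y.
    by apply/idP/idP; rewrite inE.
  by rewrite !indicE !inE' -natrM mulnb andbC.
have [s0|s0] := ltP 0%R s; last first.
  rewrite !integral0_eq// => x _; rewrite sl ltNge s0/= mulr0 mulr0//.
under eq_integral do rewrite sl s0 mulr1.
under [RHS]eq_integral do rewrite sl s0 mulr1.
rewrite h// -ge0_integralZl//.
- by apply: eq_integral => x _; rewrite -EFinM mulrA.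
- apply/measurable_EFinP; apply: measurable_funM => //.
  by apply: measurable_indic; exact: measurable_setltr.
- by move=> x _; rewrite lee_fin mulr_ge0.
Qed.

End LayerTransfer.

(** * Moment generating functions of independent Gaussian vectors *)

Section LinearForms.
Context {R : realType}.

Definition dotv {n} (u v : 'cV[R]_n) : R := (u^T *m v) 0 0.

Lemma dotvDZl {n} (u v x : 'cV[R]_n) (g : R) :
  dotv (u + g *: v) x = dotv u x + g * dotv v x.
Proof.
by rewrite /dotv [(_ + _)^T]linearD/= [(_ *: _)^T]linearZ/= mulmxDl -scalemxAl !mxE.
Qed.

Lemma measurable_dotv {n} (u : 'cV[R]_n) :
  measurable_fun setT (fun v : borel_vec n => dotv u v).
Proof.
have mcoord i : measurable_fun setT (fun v : borel_vec n => v i 0 : R).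
  apply: (measurability _ (RGenOpens.measurableE R)).
  move=> _ [_ [a [b ->] <-]]; rewrite setTI.
  apply: sub_sigma_algebra.
  move: (@coord_continuous R n 1 i 0) => /continuousP; apply.
  exact: interval_open.
under eq_fun do rewrite /dotv mxE.
by apply: measurable_sum => i; apply: measurable_funM.
Qed.

Context {disp : measure_display} {T : measurableType disp}.
Variable P : probability T R.

Lemma measurable_dotv_comp {n} (X : T -> 'cV[R]_n) (u : 'cV[R]_n) :
  random_vector X -> measurable_fun setT (fun o => dotv u (X o)).
Proof.
move=> mX; exact: (measurableT_comp (measurable_dotv u) mX).
Qed.

Local Open Scope ereal_scope.

Lemma integral_indic_ray (Y : T -> R) (s : R) : measurable_fun setT Y ->
  \int[P]_x (1 * \1_[set y | (s < Y y)%R] x)%:E = P [set y | (s < Y y)%R].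
Proof.
move=> mY; under eq_integral do rewrite mul1r.
rewrite integral_indic ?setIT//.
exact: measurable_setltr.
Qed.

(** The law of the linear form is known on the rays, which are the layers of
    expR. A degenerate form has a point mass for law, hence two cases. *)
Lemma gaussian_mgf {n} (X : T -> 'cV[R]_n) (S : 'M[R]_n) (u : 'cV[R]_n) :
  gaussian_vector P X S -> (0 <= quad S u)%R ->
  \int[P]_x (expR (dotv u (X x)))%:E = (expR (quad S u / 2))%:E.
Proof.
move=> [mX lawX] S0; pose Y (x : T) : R := expR (dotv u (X x)).
have mL := measurable_dotv_comp u mX.
have mY : measurable_fun setT Y by exact: measurableT_comp.
have mE : measurable_fun setT (expR : R -> R) by exact: measurable_expR.
have ray (s : R) : measurable [set x : R | (s < expR x)%R].
  exact: measurable_setltr.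
have Y0 x : (0 <= Y x)%R by exact: expR_ge0.
transitivity (\int[P]_x (1 * Y x)%:E).
  by apply: eq_integral => x _; rewrite mul1r.
have [Su0|Su0] := eqVneq (quad S u) 0%R.
  rewrite (@eq_integral_layers R _ _ _ _ P (dirac (0%R : R)) (cst 1%R) Y
    (cst 1%R) expR 1%R)//=; last first.
    move=> s s0; rewrite mul1e integral_indic_ray//.
    have := lawX u [set x : R | (s < expR x)%R] (ray s).
    rewrite /centered_normal Su0 eqxx => ->.
    under eq_integral do rewrite mul1r.
    by rewrite integral_indic ?setIT.
  rewrite mul1e integral_dirac//; last first.
    by apply/measurable_EFinP; apply: measurable_funM.
  by rewrite diracT mul1e mul1r Su0 mul0r.
have s0 : (0 < Num.sqrt (quad S u))%R by rewrite sqrtr_gt0 lt_neqAle eq_sym Su0.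
rewrite (@eq_integral_layers R _ _ _ _ P (@lebesgue_measure R) (cst 1%R) Y
   (normal_pdf 0%R (Num.sqrt (quad S u))) expR 1%R)//=; first last.
- move=> s s1; rewrite mul1e integral_indic_ray//.
  have := lawX u [set x : R | (s < expR x)%R] (ray s).
  rewrite /centered_normal (negbTE Su0) => ->.
  rewrite /normal_prob integral_mkcond; apply: eq_integral => x _.
  rewrite patchE indicE; case: ifPn => _; by rewrite ?mulr1 ?mulr0.
- by move=> x; exact: normal_pdf_ge0.
- exact: measurable_normal_pdf.
rewrite mul1e.
have := @integral_expR_quadratic_normal_pdf R 1 0 (Num.sqrt (quad S u)) s0.
rewrite mul0r subr0 => /(_ ltr01).
under eq_integral do rewrite mul1r !mul0r addr0.
by move=> ->; rewrite sqrtr1 invr1 mul1r mulr1 expr1n mul1r sqr_sqrtr.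
Qed.

(** Independence is the case where every factor is an indicator. The
    indicators are traded for the functions [y i] one index at a time, by
    comparing layers. *)
Lemma independent_integral_prod {n} (X : nat -> T -> 'cV[R]_n)
    (y : nat -> 'cV[R]_n -> R) (e : nat -> R) (N : nat) :
  (forall i, random_vector (X i)) -> mutually_independent P X ->
  (forall i, measurable_fun setT (y i : borel_vec n -> R)) ->
  (forall i v, 0 <= y i v)%R -> (forall i, 0 <= e i)%R ->
  (forall i, \int[P]_x (y i (X i x))%:E = (e i)%:E) ->
  \int[P]_x (\prod_(i < N) y i (X i x))%:E = (\prod_(i < N) e i)%:E.
Proof.
move=> mX iX my y0 e0 ey.
pose J := [fset i in iota 0 N]%fset.
have bigJ (f : nat -> R) : (\prod_(i < N) f i = \prod_(i <- J) f i)%R.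
  rewrite -(big_mkord xpredT) /index_iota subn0; apply: perm_big.
  apply: uniq_perm; rewrite ?iota_uniq ?fset_uniq//.
  by move=> i; rewrite !inE.
have mYX i : measurable_fun setT (fun x => y i (X i x)).
  exact: (measurableT_comp (my i) (mX i)).
have mB i (B : set (borel_vec n)) : measurable B -> measurable (X i @^-1` B).
  by move=> mB; rewrite -[X in measurable X]setTI; exact: mX.
(* F k B: the factors of index less than k are functions, the others are
   still indicators. *)
pose F k (B : nat -> set (borel_vec n)) i x : R :=
  if (i < k)%N then y i (X i x) else \1_(X i @^-1` B i) x.
pose G k (B : nat -> set (borel_vec n)) i : R :=
  if (i < k)%N then e i else fine (P (X i @^-1` B i)).
have claim k : forall B, (forall i, measurable (B i)) ->
    \int[P]_x (\prod_(i <- J) F k B i x)%:E = (\prod_(i <- J) G k B i)%:E.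
  elim: k => [|k IH] B hB.
    transitivity (\int[P]_x (\1_(\bigcap_(i in [set` J]) (X i @^-1` B i)) x)%:E).
      apply: eq_integral => x _; congr EFin; rewrite /F/= indicE.
      have [hx|hx] := pselect ((\bigcap_(i in [set` J]) (X i @^-1` B i)) x).
        rewrite mem_set// big_seq big1// => i iJ; rewrite indicE mem_set//.
        exact: hx.
      rewrite memNset//.
      have [i iJ nBi] : exists2 i, i \in J & ~ B i (X i x).
        apply: contrapT => h; apply: hx => i iJ.
        by apply: contrapT => nB; apply: h; exists i.
      rewrite (big_rem i)//= indicE memNset ?mul0r//.
    rewrite integral_indic ?setIT//; last first.
      by apply: fin_bigcap_measurable => // i _; exact: mB.
    rewrite [LHS](iX J B (fun i _ => hB i)) -prodEFin; apply: eq_bigr => i _.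
    by rewrite fineK// fin_num_measure//; exact: mB.
  have [kJ|kJ] := boolP (k \in J); last first.
    have ik i : i \in J -> (i < k.+1)%N = (i < k)%N.
      by move=> iJ; rewrite ltnS leq_eqVlt; case: eqP iJ kJ => // -> ->.
    transitivity (\int[P]_x (\prod_(i <- J) F k B i x)%:E).
      apply: eq_integral => x _; congr EFin; apply: eq_big_seq => i iJ.
      by rewrite /F ik.
    by rewrite IH//; congr EFin; apply: eq_big_seq => i iJ; rewrite /G ik.
  (* The ray of the factor k is an event of the previous stage. *)
  pose B' s i := if i == k then [set v : borel_vec n | (s < y k v)%R] else B i.
  have mB' s i : measurable (B' s i).
    rewrite /B'; case: ifP => _ //; exact: measurable_setltr.
  pose Z x := (\prod_(i <- J | i != k) F k.+1 B i x)%R.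
  pose a := (\prod_(i <- J | i != k) G k.+1 B i)%R.
  have ik i : i != k -> (i < k.+1)%N = (i < k)%N.
    by rewrite ltnS leq_eqVlt => /negbTE ->.
  have FE x : (\prod_(i <- J) F k.+1 B i x = Z x * y k (X k x))%R.
    by rewrite (bigD1_seq k)//= ?fset_uniq// {1}/F ltnSn mulrC.
  have F0 k' B0 i x : (0 <= F k' B0 i x)%R by rewrite /F; case: ifP.
  have G0 k' B0 i : (0 <= G k' B0 i)%R by rewrite /G; case: ifP => // _; exact: fine_ge0.
  under eq_integral do rewrite FE.
  rewrite (@eq_integral_layers R _ _ _ _ P P Z (fun x => y k (X k x)) (cst 1%R)
    (fun x => y k (X k x)) a)//; first last.
  - move=> s s0; rewrite integral_indic_ray//.
    have -> : P [set x | (s < y k (X k x))%R] =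
        (fine (P [set x | (s < y k (X k x))%R]))%:E.
      rewrite fineK// fin_num_measure//; exact: measurable_setltr.
    transitivity (\int[P]_x (\prod_(i <- J) F k (B' s) i x)%:E).
      apply: eq_integral => x _; congr EFin.
      rewrite (bigD1_seq k)//= ?fset_uniq// {1}/F ltnn [RHS]mulrC; congr (_ * _)%R.
        by apply: eq_bigr => i ik'; rewrite /F ik// /B' (negbTE ik').
      by rewrite /B' eqxx.
    rewrite IH// -EFinM; congr EFin.
    rewrite (bigD1_seq k)//= ?fset_uniq// {1}/G ltnn mulrC; congr (_ * _)%R.
      by apply: eq_bigr => i ik'; rewrite /G ik// /B' (negbTE ik').
    by rewrite /B' eqxx.
  - by rewrite /a prodr_ge0.
  - by move=> x; rewrite /Z prodr_ge0.
  - have -> : Z = (fun x => \prod_(i <- [seq i <- enum_fset J | i != k]) F k.+1 B i x)%R.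
      by apply/funext => x; rewrite big_filter.
    apply: measurable_prod => i _; rewrite /F; case: (i < k.+1)%N => //.
    by apply: measurable_indic; exact: mB.
  under eq_integral do rewrite mul1r.
  rewrite ey -EFinM; congr EFin.
  by rewrite (bigD1_seq k)//= ?fset_uniq// [RHS]mulrC; congr (_ * _)%R; rewrite /G ltnSn.
under eq_integral => x _ do rewrite (bigJ (fun i => y i (X i x))).
rewrite bigJ.
have := claim N (fun=> setT) (fun=> measurableT).
have JN i : i \in J -> (i < N)%N by rewrite !inE/= mem_iota.
move=> h.
transitivity (\int[P]_x (\prod_(i <- J) F N (fun=> setT) i x)%:E).
  apply: eq_integral => x _; congr EFin; apply: eq_big_seq => i iJ.
  by rewrite /F JN.
by rewrite h; congr EFin; apply: eq_big_seq => i iJ; rewrite /G JN.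
Qed.

End LinearForms.

(** * Positive definite matrices *)

Section DetSylvester.

(** Both sides are the determinant of the block matrix [1 A; B 1]. *)
Lemma det_sylvester {F : comNzRingType} m n (A : 'M[F]_(m, n)) (B : 'M[F]_(n, m)) :
  \det (1%:M - A *m B) = \det (1%:M - B *m A).
Proof.
pose X := block_mx 1%:M A B 1%:M.
transitivity (\det X).
  have -> : \det X = \det (block_mx 1%:M (- A) 0 1%:M *m X).
    by rewrite det_mulmx det_ublock !det1 !mul1r.
  rewrite /X mulmx_block !mul1mx !mul0mx !mulmx1 !add0r mulNmx subrr.
  by rewrite det_lblock det1 mulr1.
have -> : \det X = \det (block_mx 1%:M 0 (- B) 1%:M *m X).
  by rewrite det_mulmx det_lblock !det1 !mul1r.
rewrite /X mulmx_block !mul1mx !mul0mx !mulmx1 !addr0 mulNmx addNr det_ublock.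
by rewrite det1 mul1r addrC.
Qed.

End DetSylvester.

Section PosDef.
Context {R : realType}.
Implicit Types n : nat.

Definition bilin {n} (M : 'M[R]_n) (u v : 'cV[R]_n) : R := (u^T *m M *m v) 0 0.

Lemma bilinC n (M : 'M[R]_n) u v : M^T = M -> bilin M u v = bilin M v u.
Proof.
move=> sM; rewrite /bilin -[in LHS](trmxK (u^T *m M *m v)) mxE.
by rewrite !trmx_mul trmxK sM mulmxA.
Qed.

Lemma quadE n (M : 'M[R]_n) u : quad M u = bilin M u u. Proof. by []. Qed.

Lemma quadDZ n (M : 'M[R]_n) (c : R) u v : M^T = M ->
  quad M (u + c *: v) = quad M u + 2 * c * bilin M v u + c ^+ 2 * quad M v.
Proof.
move=> sM; have vu := bilinC v u sM; move: vu; rewrite /quad /bilin => vu.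
rewrite [(_ + _)^T]linearD/= [(_ *: _)^T]linearZ/= !mulmxDl !mulmxDr -!scalemxAl -!scalemxAr.
by rewrite !mxE in vu *; rewrite -vu; ring.
Qed.

Lemma quadD n (M N : 'M[R]_n) v : quad (M + N) v = quad M v + quad N v.
Proof. by rewrite /quad mulmxDr mulmxDl mxE. Qed.

Lemma quadZ n (M : 'M[R]_n) (c : R) v : quad (c *: M) v = c * quad M v.
Proof. by rewrite /quad -scalemxAr -scalemxAl mxE. Qed.

Lemma quad_congr m n (M : 'M[R]_n) (A : 'M[R]_(n, m)) (v : 'cV[R]_m) :
  quad (A^T *m M *m A) v = quad M (A *m v).
Proof. by rewrite /quad trmx_mul !mulmxA. Qed.

Lemma quad_rank1 n (f v : 'cV[R]_n) : quad (f *m f^T) v = ((f^T *m v) 0 0) ^+ 2.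
Proof.
rewrite /quad mulmxA -mulmxA mxE big_ord1 expr2; congr (_ * _).
by rewrite -[in LHS](trmxK (v^T *m f)) mxE trmx_mul trmxK.
Qed.

Lemma quad0 n (M : 'M[R]_n) : quad M 0 = 0.
Proof. by rewrite /quad mulmx0 mxE. Qed.

Lemma posdef_psd n (M : 'M[R]_n) : posdefmx M -> possemidefmx M.
Proof.
move=> [sM pM]; split=> // v; have [->|v0] := eqVneq v 0; first by rewrite quad0.
exact/ltW/pM.
Qed.

Lemma psdD n (M N : 'M[R]_n) : possemidefmx M -> possemidefmx N ->
  possemidefmx (M + N).
Proof.
move=> [sM pM] [sN pN]; split; first by rewrite linearD/= sM sN.
by move=> v; rewrite quadD addr_ge0.
Qed.

Lemma posdefD n (M N : 'M[R]_n) : posdefmx M -> possemidefmx N ->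
  posdefmx (M + N).
Proof.
move=> [sM pM] [sN pN]; split; first by rewrite linearD/= sM sN.
by move=> v v0; rewrite quadD ltr_wpDr// pM.
Qed.

Lemma psdZ n (M : 'M[R]_n) (c : R) : 0 <= c -> possemidefmx M ->
  possemidefmx (c *: M).
Proof.
move=> c0 [sM pM]; split; first by rewrite linearZ/= sM.
by move=> v; rewrite quadZ mulr_ge0.
Qed.

Lemma psd_congr m n (M : 'M[R]_n) (A : 'M[R]_(n, m)) : possemidefmx M ->
  possemidefmx (A^T *m M *m A).
Proof.
move=> [sM pM]; split; first by rewrite !trmx_mul trmxK sM mulmxA.
by move=> v; rewrite quad_congr.
Qed.

Lemma psd_rank1 n (f : 'cV[R]_n) : possemidefmx (f *m f^T).
Proof.
split; first by rewrite trmx_mul trmxK.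
by move=> v; rewrite quad_rank1 sqr_ge0.
Qed.

Lemma posdef_unit n (M : 'M[R]_n) : posdefmx M -> M \in unitmx.
Proof.
move=> [sM pM]; rewrite -row_free_unit -kermx_eq0; apply/negPn/negP => /rowV0Pn[v].
move=> /sub_kermxP vM v0; have : 0 < quad M v^T.
  by apply: pM; apply: contra v0 => /eqP v0; rewrite -[v]trmxK v0 trmx0.
by rewrite /quad trmxK vM mul0mx mxE ltxx.
Qed.

Lemma posdef_inv n (M : 'M[R]_n) : posdefmx M -> posdefmx (invmx M).
Proof.
move=> pdM; have uM := posdef_unit pdM; have [sM pM] := pdM.
have sI : (invmx M)^T = invmx M by rewrite trmx_inv sM.
split=> // v v0.
have <- : (invmx M)^T *m M *m invmx M = invmx M by rewrite sI mulVmx// mul1mx.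
rewrite quad_congr; apply: pM; apply: contra v0 => /eqP e.
by rewrite -[v]mul1mx -(mulmxV uM) -mulmxA e mulmx0.
Qed.

(** Cholesky factorization by induction on the number of rows that may be
    nonzero: the last such row is cleared by subtracting a rank one matrix,
    and what is left is positive semidefinite by the Cauchy-Schwarz
    inequality. If the diagonal entry vanishes, so does the row, and the
    column [f] of the factor is 0 because the inverse of 0 is 0. *)
Lemma psd_factor_rows n k (V : 'M[R]_n) : (k <= n)%N -> possemidefmx V ->
  (forall (i j : 'I_n), (k <= i)%N -> V i j = 0) ->
  exists F : 'M[R]_(n, k), V = F *m F^T.
Proof.
elim: k V => [|k IH] V kn psV V0.
  by exists 0; rewrite mul0mx; apply/matrixP => i j; rewrite V0// mxE.
have [sV pV] := psV.
pose i0 := Ordinal kn; pose e : 'cV[R]_n := delta_mx i0 0.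
have be v : bilin V e v = (V *m v) i0 0.
  by rewrite /bilin /e trmx_delta -mulmxA -rowE mxE.
have qe : quad V e = V i0 i0.
  by rewrite quadE be /e -colE mxE.
have Vsym i j : V i j = V j i by rewrite -[in LHS]sV mxE.
pose c : R := (V i0 i0)^-1; pose f := Num.sqrt c *: col i0 V.
have c0 : 0 <= c by rewrite invr_ge0 -qe.
have fE i j : (f *m f^T) i j = c * (V i i0 * V j i0).
  rewrite mxE big_ord1 !mxE -[c in RHS](sqr_sqrtr c0); ring.
have Vi0 j : V i0 i0 = 0 -> V i0 j = 0.
  move=> z; apply/eqP/negPn/negP => nz.
  pose ej : 'cV[R]_n := delta_mx j 0.
  have bj : bilin V e ej = V i0 j by rewrite be /ej -colE mxE.
  (* The multiple of e that makes the quadratic form equal to -1. *)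
  pose t := - (quad V ej + 1) / (2 * V i0 j).
  have := pV (ej + t *: e); rewrite quadDZ// bj qe z mulr0 addr0.
  have -> : 2 * t * V i0 j = - (quad V ej + 1) by rewrite /t; field.
  by rewrite opprD addrA subrr add0r lerNr oppr0 ler10.
have psV' : possemidefmx (V - f *m f^T).
  split; first by rewrite linearB/= sV trmx_mul trmxK.
  move=> v; rewrite quadD -scaleN1r quadZ mulN1r quad_rank1.
  have -> : ((f^T *m v) 0 0) ^+ 2 = c * (bilin V e v) ^+ 2.
    rewrite /f linearZ/= -scalemxAl mxE exprMn sqr_sqrtr//; congr (_ * _ ^+ 2).
    by rewrite tr_col sV be -row_mul mxE.
  have [z|nz] := eqVneq (V i0 i0) 0.
    by rewrite /c z invr0 mul0r subr0.
  (* The minimizer of the form on the line through v directed by e. *)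
  have := pV (v + (- c * bilin V e v) *: e); rewrite quadDZ// qe.
  rewrite (_ : _ + _ + _ = quad V v - c * bilin V e v ^+ 2)//.
  by rewrite /c; field.
have [i j ki|F EF] := IH _ (ltnW kn) psV'.
  rewrite mxE [in X in _ + X]mxE fE.
  have [ii0|ii0] := eqVneq i i0.
    rewrite ii0; have [z|nz] := eqVneq (V i0 i0) 0; first by rewrite !(Vi0 _ z) mul0r mulr0 subrr.
    by rewrite /c mulKf// Vsym subrr.
  have ki' : (k < i)%N.
    by rewrite ltn_neqAle ki andbT; apply: contra ii0 => /eqP ki'; apply/eqP/val_inj.
  by rewrite (V0 i j ki') (V0 i i0 ki') mul0r mulr0 subrr.
have E : row_mx f F *m (row_mx f F)^T = V.
  by rewrite tr_row_mx mul_row_col -EF addrC subrK.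
by exists (row_mx f F); rewrite -[LHS]E.
Qed.

Lemma psd_factor n (V : 'M[R]_n) : possemidefmx V -> exists F : 'M[R]_n, V = F *m F^T.
Proof.
move=> pV; apply: psd_factor_rows => // i j; by rewrite leqNgt ltn_ord.
Qed.

Lemma psd_sum_rank1 n (V : 'M[R]_n) : possemidefmx V ->
  exists fs : seq 'cV[R]_n, V = \sum_(f <- fs) f *m f^T.
Proof.
move=> /psd_factor[F ->]; exists [seq col j F | j : 'I_n].
rewrite big_image/=; apply/matrixP => i j; rewrite mxE summxE.
by apply: eq_bigr => k _; rewrite !mxE big_ord1 !mxE.
Qed.

Lemma psd_sum n (fs : seq 'cV[R]_n) : possemidefmx (\sum_(f <- fs) f *m f^T).
Proof.
elim: fs => [|f fs IH]; last by rewrite big_cons; apply: psdD => //; exact: psd_rank1.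
rewrite big_nil; split; first by rewrite trmx0.
by move=> v; rewrite /quad mulmx0 mul0mx mxE.
Qed.

Lemma posdef_det_gt0 n (M : 'M[R]_n) : posdefmx M -> 0 < \det M.
Proof.
move=> pM; have := posdef_unit pM; rewrite unitmxE unitfE => d0.
rewrite lt_neqAle eq_sym d0/=; have [F ->] := psd_factor (posdef_psd pM).
by rewrite det_mulmx det_tr -expr2 sqr_ge0.
Qed.

(** The determinant and the inverse of a rank one perturbation
    (Sherman-Morrison). The coefficient [c] is 1 when a weight is applied
    and -1 when determinants are compared. *)
Section RankOne.
Variables (n : nat) (Y : 'M[R]_n) (f : 'cV[R]_n) (c : R).
Hypotheses (pY : posdefmx Y) (pYf : posdefmx (Y - c *: (f *m f^T))).
Let s := quad (invmx Y) f.

Lemma det_rank1_update : \det (Y - c *: (f *m f^T)) = \det Y * (1 - c * s).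
Proof.
have uY := posdef_unit pY.
have -> : Y - c *: (f *m f^T) = Y *m (1%:M - (c *: (invmx Y *m f)) *m f^T).
  by rewrite mulmxBr mulmx1 -scalemxAl -scalemxAr !mulmxA mulmxV// mul1mx.
rewrite det_mulmx det_sylvester; congr (_ * _).
have e1 (M : 'M[R]_1) : (1%:M - c *: M) 0 0 = 1 - c * M 0 0 by rewrite !mxE eqxx.
by rewrite det_mx11 -scalemxAr mulmxA e1.
Qed.

Lemma rank1_update_lt1 : 0 < 1 - c * s.
Proof.
by have := posdef_det_gt0 pYf; rewrite det_rank1_update pmulr_rgt0// posdef_det_gt0.
Qed.

Lemma quad_inv_rank1_update u :
  quad (invmx (Y - c *: (f *m f^T))) u =
  quad (invmx Y) u + c * (bilin (invmx Y) f u) ^+ 2 / (1 - c * s).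
Proof.
have uY := posdef_unit pY; have [sY _] := pY.
have sI : (invmx Y)^T = invmx Y by rewrite trmx_inv sY.
have s1 := rank1_update_lt1.
set k := 1 - c * s in s1 *.
pose g := invmx Y *m f.
have fg : f^T *m g = s%:M by rewrite /g mulmxA [LHS]mx11_scalar.
have -> : invmx (Y - c *: (f *m f^T)) = invmx Y + (c / k) *: (g *m g^T).
  have uYf := posdef_unit pYf.
  rewrite -[RHS]mul1mx -[in RHS](mulVmx uYf) -[in LHS](mulmx1 (invmx _)) -mulmxA.
  congr (_ *m _); rewrite mulmxDr !mulmxBl mulmxV// -!scalemxAl -!scalemxAr.
  have -> : Y *m (g *m g^T) = f *m g^T by rewrite /g !mulmxA mulmxV// mul1mx.
  have -> : f *m f^T *m invmx Y = f *m g^T.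
    by rewrite /g trmx_mul sI mulmxA.
  have -> : f *m f^T *m (g *m g^T) = s *: (f *m g^T).
    by rewrite mulmxA -(mulmxA f) fg mul_mx_scalar -scalemxAl.
  rewrite !scalerA -scalerBl addrAC -addrA -scalerBl.
  rewrite (_ : _ - _ - _ = 0) ?scale0r ?addr0//.
  by rewrite /k; field; rewrite gt_eqF.
rewrite quadD quadZ quad_rank1; congr (_ + _).
by rewrite /g trmx_mul sI /bilin mulrAC.
Qed.

End RankOne.

Lemma det_add_psd_ge n (Y V : 'M[R]_n) : posdefmx Y -> possemidefmx V ->
  \det Y <= \det (Y + V).
Proof.
move=> pY /psd_sum_rank1[fs ->]; elim: fs Y pY => [|f fs IH] Y pY.
  by rewrite big_nil addr0.
have pYf : posdefmx (Y - (-1) *: (f *m f^T)).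
  by rewrite scaleN1r opprK; apply: posdefD => //; exact: psd_rank1.
rewrite big_cons addrA; apply: le_trans (IH _ _); last first.
  by move: pYf; rewrite scaleN1r opprK.
have := det_rank1_update f (-1) pY; rewrite scaleN1r opprK => ->.
rewrite ler_peMr//; first exact/ltW/posdef_det_gt0.
rewrite mulN1r opprK lerDl.
by have [_] := posdef_psd (posdef_inv pY); apply.
Qed.

End PosDef.

(** * Quadratic exponential weights *)

Section Tilting.
Context {R : realType} {disp : measure_display} {T : measurableType disp}.
Variable P : probability T R.
Local Open Scope ereal_scope.
Local Notation leb := (@lebesgue_measure R).

(** The factor [sqrt (det Y)] makes the constant [c] invariant when the weight
    is multiplied by the exponential of a quadratic form. *)
Definition gaussian_weighted {n} (Z : T -> R) (x : T -> 'cV[R]_n) (c : R)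
    (Y : 'M[R]_n) : Prop :=
  forall u : 'cV[R]_n,
    \int[P]_o (Z o * expR (dotv u (x o)))%:E
    = (c / Num.sqrt (\det Y) * expR (quad (invmx Y) u / 2))%:E.

(** The Hubbard-Stratonovich transform: [exp (z^2 / 2)] is the integral of
    [exp (g z)] over a standard normal [g], and [exp (g z)] only shifts [u]
    by [g f]. *)
Lemma gaussian_weighted_rank1 {n} (Z : T -> R) (x : T -> 'cV[R]_n) (c : R)
    (Y : 'M[R]_n) (f : 'cV[R]_n) :
  measurable_fun setT Z -> (forall o, 0 <= Z o)%R -> (0 <= c)%R ->
  (forall u : 'cV[R]_n, measurable_fun setT (fun o => dotv u (x o))) ->
  posdefmx Y -> posdefmx (Y - f *m f^T) ->
  gaussian_weighted Z x c Y ->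
  gaussian_weighted (fun o => Z o * expR (quad (f *m f^T) (x o) / 2))%R x c
    (Y - f *m f^T).
Proof.
move=> mZ Z0 c0 mx pY pYf ZY u.
pose z o : R := dotv f (x o); pose a o : R := dotv u (x o).
pose s := quad (invmx Y) f; pose t := bilin (invmx Y) f u.
have pYf1 : posdefmx (Y - 1 *: (f *m f^T)) by rewrite scale1r.
have s1 : (0 < 1 - s)%R by have := rank1_update_lt1 pY pYf1; rewrite mul1r.
have sI : (invmx Y)^T = invmx Y by have [] := posdef_inv pY.
pose h (q : T * R) : \bar R :=
  (Z q.1 * (normal_pdf 0 1 q.2 * expR (a q.1 + z q.1 * q.2)))%:E.
have mh : measurable_fun setT h.
  apply/measurable_EFinP; apply: measurable_funM; first exact: measurableT_comp.
  apply: measurable_funM.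
    exact: (measurableT_comp (measurable_normal_pdf 0 1)).
  apply: measurableT_comp => //; apply: measurable_funD.
    exact: (measurableT_comp (mx u)).
  apply: measurable_funM => //.
  exact: (measurableT_comp (mx f)).
have h0 q : 0 <= h q.
  by rewrite lee_fin !mulr_ge0// ?expR_ge0// normal_pdf_ge0.
have mpdf (b k : R) : measurable_fun setT
    (fun g : R => (normal_pdf 0 1 g * expR (b * g + k * g ^+ 2 / 2))%R).
  apply: measurable_funM; first exact: measurable_normal_pdf.
  apply: measurableT_comp => //; apply: measurable_funD; first exact: measurable_funM.
  apply: measurable_funM => //; apply: measurable_funM => //.
transitivity (\int[P]_o \int[leb]_g h (o, g)).
  apply: eq_integral => o _.
  pose k := (Z o * expR (a o))%R.
  transitivity (k%:E * \int[leb]_g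
      (normal_pdf 0 1 g * expR (z o * g + 0 * g ^+ 2 / 2))%:E).
    rewrite integral_expR_quadratic_normal_pdf ?mul0r// !expr1n mulr1 subr0 sqrtr1.
    rewrite invr1 mul1r mulr1 -EFinM; congr EFin.
    by rewrite quad_rank1 /k -/(a o) -/(z o); ring.
  rewrite -ge0_integralZl//.
  - apply: eq_integral => g _; rewrite -EFinM; congr EFin.
    by rewrite /k/= mul0r mul0r addr0 expRD; ring.
  - by apply/measurable_EFinP; exact: mpdf.
  - by move=> g _; rewrite lee_fin mulr_ge0 ?expR_ge0// normal_pdf_ge0.
  - by rewrite lee_fin mulr_ge0 ?expR_ge0.
rewrite (fubini_tonelli (m1 := P) (m2 := leb) h mh h0).
pose C := (c / Num.sqrt (\det Y) * expR (quad (invmx Y) u / 2))%R.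
transitivity (\int[leb]_g (C%:E *
   (normal_pdf 0 1 g * expR (t * g + s * g ^+ 2 / 2))%:E)).
  apply: eq_integral => g _.
  have aux o : h (o, g) = (normal_pdf 0 1 g)%:E *
      (Z o * expR (dotv (u + g *: f)%R (x o)))%:E.
    rewrite -EFinM; congr EFin; rewrite /= mulrCA; congr (_ * (_ * expR _))%R.
    by rewrite dotvDZl mulrC.
  under eq_integral do rewrite aux.
  rewrite ge0_integralZl//.
  - rewrite ZY -!EFinM; congr EFin; rewrite quadDZ// -/s -/t /C.
    rewrite (_ : (_ + _ + _) / 2 = quad (invmx Y) u / 2 + (t * g + s * g ^+ 2 / 2))%R.
      by rewrite expRD; ring.
    by field.
  - apply/measurable_EFinP; apply: measurable_funM => //.
    by apply: measurableT_comp.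
  - by move=> o _; rewrite lee_fin mulr_ge0 ?expR_ge0.
  - by rewrite lee_fin normal_pdf_ge0.
rewrite ge0_integralZl//.
- rewrite integral_expR_quadratic_normal_pdf ?expr1n ?mulr1//; last by rewrite -subr_gt0.
  rewrite -EFinM; congr EFin.
  have := det_rank1_update f 1 pY; rewrite scale1r mul1r -/s => ->.
  have := quad_inv_rank1_update pY pYf1 u; rewrite scale1r !mul1r -/s -/t => ->.
  rewrite mulrDl expRD sqrtrM ?ltW ?posdef_det_gt0// invfM /C; ring.
- by apply/measurable_EFinP; exact: mpdf.
- by move=> g _; rewrite lee_fin mulr_ge0 ?expR_ge0// normal_pdf_ge0.
- by rewrite lee_fin !mulr_ge0 ?expR_ge0// invr_ge0 sqrtr_ge0.
Qed.

(** Subtracting the rank one terms one by one keeps the precision positive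
    definite, since every intermediate matrix dominates [Y - V]. *)
Lemma gaussian_weighted_tilt {n} (Z : T -> R) (x : T -> 'cV[R]_n) (c : R)
    (Y V : 'M[R]_n) :
  measurable_fun setT Z -> (forall o, 0 <= Z o)%R -> (0 <= c)%R ->
  (forall u : 'cV[R]_n, measurable_fun setT (fun o => dotv u (x o))) ->
  possemidefmx V -> posdefmx (Y - V) ->
  gaussian_weighted Z x c Y ->
  gaussian_weighted (fun o => Z o * expR (quad V (x o) / 2))%R x c (Y - V).
Proof.
move=> mZ Z0 c0 mx /psd_sum_rank1[fs ->].
elim: fs Z Y mZ Z0 => [|f fs IH] Z Y mZ Z0; rewrite ?big_nil ?big_cons.
  rewrite subr0 => _ ZY u; rewrite -ZY; apply: eq_integral => o _.
  by rewrite /quad mulmx0 mul0mx mxE mul0r expR0 mulr1.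
move=> pYV ZY.
have pYf : posdefmx (Y - f *m f^T).
  rewrite [X in posdefmx X](_ : _ = Y - (f *m f^T + \sum_(j <- fs) j *m j^T)
    + \sum_(j <- fs) j *m j^T)%R; last by rewrite opprD addrA subrK.
  by apply: posdefD => //; exact: psd_sum.
have pY : posdefmx Y.
  by rewrite -(subrK (f *m f^T) Y); apply: posdefD => //; exact: psd_rank1.
have mq : measurable_fun setT (fun o => quad (f *m f^T) (x o)).
  by under eq_fun do rewrite quad_rank1; exact: (measurable_funX 2 (mx f)).
pose Zf o := (Z o * expR (quad (f *m f^T) (x o) / 2))%R.
have mZf : measurable_fun setT Zf.
  apply: measurable_funM => //; apply: measurableT_comp => //.
  exact: measurable_funM.
have Zf0 o : (0 <= Zf o)%R by rewrite mulr_ge0 ?expR_ge0.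
move=> u; rewrite opprD addrA.
have pYV' : posdefmx (Y - f *m f^T - \sum_(j <- fs) j *m j^T).
  by rewrite -addrA -opprD.
rewrite -(IH Zf _ mZf Zf0 pYV' (gaussian_weighted_rank1 mZ Z0 c0 mx pY pYf ZY) u).
by apply: eq_integral => o _; rewrite quadD mulrDl expRD !mulrA.
Qed.

End Tilting.

(** * One step of the Riccati recursion *)

Section RiccatiStep.
Context {R : realType} {m : nat}.
Variables (F p W Wh T : 'M[R]_m).
Hypotheses (pp : possemidefmx p) (pW : posdefmx W) (pWp : posdefmx (invmx W - p)).
Hypothesis WhE : Wh = invmx (invmx W - p).
Hypothesis pT : posdefmx T.

(** [phi] is [beta] times the bracket of the Riccati equation, [nu] the part of [p] that
    comes from the future cost, [T] the inverse of the covariance of the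
    state under the reweighted law, so that [T + p] is the precision of the
    state before its cost is counted and [T + nu] after. [S] and [X] are the
    covariances of the current state once its cost is counted and of the next
    state; [G] and [Wh] are the closed loop and the noise covariance under
    the reweighted law. *)
Let phi := p + p *m Wh *m p.
Let nu := F^T *m phi *m F.
Let G := (1%:M + Wh *m p) *m F.
Let S := invmx (T + nu).
Let X := F *m S *m F^T + W.
Let Sig' := G *m invmx T *m G^T + Wh.

Lemma posdef_tilted_noise : posdefmx Wh. Proof. by rewrite WhE; exact: posdef_inv. Qed.

Lemma psd_risk_adjusted : possemidefmx phi.
Proof.
apply: psdD => //; have [sp _] := pp; rewrite -[X in X *m Wh]sp.
exact/psd_congr/posdef_psd/posdef_tilted_noise.
Qed.

Lemma psd_pulled_back : possemidefmx nu. Proof. exact/psd_congr/psd_risk_adjusted. Qed.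

Lemma posdef_weighted_prec : posdefmx (T + nu). Proof. exact/posdefD/psd_pulled_back. Qed.

Lemma posdef_pred_cov : posdefmx X.
Proof.
rewrite /X addrC; apply: posdefD => //.
rewrite -[X in X *m S]trmxK; apply/psd_congr/posdef_psd/posdef_inv.
exact: posdef_weighted_prec.
Qed.

Lemma posdef_next_tilted_cov : posdefmx Sig'.
Proof.
rewrite /Sig' addrC; apply: posdefD; first exact: posdef_tilted_noise.
rewrite -[X in X *m invmx T]trmxK; exact/psd_congr/posdef_psd/posdef_inv.
Qed.

Lemma tilted_noise_mul : Wh *m (1%:M - p *m W) = W.
Proof.
have uW := posdef_unit pW.
rewrite -{1}(mulVmx uW) -mulmxBl mulmxA WhE mulVmx ?mul1mx//.
exact: posdef_unit.
Qed.

Lemma tilt_mulr : (1%:M + p *m Wh) *m (1%:M - p *m W) = 1%:M.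
Proof. by rewrite mulmxDl mul1mx -mulmxA tilted_noise_mul subrK. Qed.

Lemma tilt_mull : (1%:M - p *m W) *m (1%:M + p *m Wh) = 1%:M.
Proof. exact/mulmx1C/tilt_mulr. Qed.

(** Since [1 + p Wh] is the inverse of [1 - p W], [phi] is [(1 - p W)^-1 p]. *)
Lemma tilt_mulp : (1%:M + p *m Wh) *m p = phi.
Proof. by rewrite mulmxDl mul1mx. Qed.

Lemma residual_factor : 1%:M - p *m X = (1%:M - p *m W) *m (1%:M - phi *m F *m S *m F^T).
Proof.
rewrite mulmxBr mulmx1 -tilt_mulp !mulmxA tilt_mull mul1mx.
by rewrite /X mulmxDr opprD addrCA addrC !mulmxA.
Qed.

Lemma weighted_cov_resolvent : invmx T - invmx T *m nu *m S = S.
Proof.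
have uT := posdef_unit pT; have uTD := posdef_unit posdef_weighted_prec.
have {1}-> : invmx T = invmx T *m (T + nu) *m S by rewrite -mulmxA mulmxV// mulmx1.
by rewrite mulmxDr mulVmx// mulmxDl mul1mx addrK.
Qed.

Lemma next_tilted_cov_mul : Sig' *m (1%:M - p *m X) = X.
Proof.
have [sWh _] := posdef_tilted_noise; have [sp _] := pp.
have GT : G^T = F^T *m (1%:M + p *m Wh).
  by rewrite /G trmx_mul linearD/= trmx1 trmx_mul sWh sp.
rewrite /Sig' mulmxDl.
have -> : Wh *m (1%:M - p *m X) = W - Wh *m p *m (F *m S *m F^T).
  by rewrite /X mulmxDr opprD addrA addrAC mulmxBr tilted_noise_mul !mulmxA.
have -> : G *m invmx T *m G^T *m (1%:M - p *m X) =
    (1%:M + Wh *m p) *m (F *m S *m F^T).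
  rewrite residual_factor GT -!mulmxA (mulmxA (1%:M + p *m Wh)) tilt_mulr mul1mx.
  rewrite /G -?mulmxA; congr (_ *m (_ *m _)).
  rewrite mulmxBr mulmx1 mulmxBr !mulmxA -mulmxBl.
  by rewrite -[in RHS]weighted_cov_resolvent /nu !mulmxA.
by rewrite mulmxDl mul1mx addrACA subrr addr0.
Qed.

(** The affine recursion of [Sig'] solves the nonlinear recursion of the
    precisions. *)
Lemma precision_step : invmx X = invmx Sig' + p.
Proof.
have uX := posdef_unit posdef_pred_cov; have uS := posdef_unit posdef_next_tilted_cov.
have TX : invmx Sig' *m X = 1%:M - p *m X.
  by rewrite -{1}next_tilted_cov_mul mulmxA mulVmx// mul1mx.
have e : (invmx Sig' + p) *m X = 1%:M by rewrite mulmxDl TX subrK.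
by rewrite -[LHS]mul1mx -e -mulmxA mulmxV// mulmx1.
Qed.

(** This makes the normalizing constants telescope: [det T] is carried to
    [det (invmx Sig')] and only [det (1 - p W)] is left at each step. *)
Lemma det_precision_step : \det (invmx Sig') * \det (T + nu) =
  \det (invmx Sig' + p) * (\det (1%:M - p *m W) * \det T).
Proof.
have uX := posdef_unit posdef_pred_cov; have uS := posdef_unit posdef_next_tilted_cov.
have uTD := posdef_unit posdef_weighted_prec.
have TX : invmx Sig' *m X = 1%:M - p *m X.
  by rewrite -{1}next_tilted_cov_mul mulmxA mulVmx// mul1mx.
have d1 : \det (1%:M - phi *m F *m S *m F^T) = \det S * \det T.
  rewrite -(mulmxA (phi *m F)) det_sylvester -det_mulmx; congr (\det _).
  have -> : S *m F^T *m (phi *m F) = S *m nu by rewrite /nu !mulmxA.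
  by rewrite -{1}(mulVmx uTD) -mulmxBr addrK.
have d2 : \det (invmx Sig') * \det X = \det (1%:M - p *m W) * (\det S * \det T).
  by rewrite -det_mulmx TX residual_factor det_mulmx d1.
have d3 : \det S * \det (T + nu) = 1 by rewrite -det_mulmx mulVmx// det1.
have d4 : \det X * \det (invmx Sig' + p) = 1.
  by rewrite -precision_step -det_mulmx mulmxV// det1.
rewrite -[\det (invmx Sig')]mulr1 -[X in _ * X * _]d4 mulrA d2.
rewrite -[RHS]mulr1 -[X in _ = _ * X]d3; ring.
Qed.

End RiccatiStep.

(** * Summability of the powers of a stable matrix *)

Section PowersSummable.
Context {R : realType}.
Local Notation C := (complex R).
Local Notation normc := (@ComplexField.Normc.normc R).

(** Summing the triangle inequality over n bounds (1 - |z|) times the partial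
    sum by |a 0| + B. *)
Lemma bounded_sum_recurrence (a b : nat -> C) (z : C) (B : R) :
  normc z < 1 -> (forall n, a n.+1 = z * a n + b n) ->
  (forall N, \sum_(n < N) normc (b n) <= B) ->
  forall N, \sum_(n < N) normc (a n) <= (normc (a 0%N) + B) / (1 - normc z).
Proof.
move=> z1 ab bB; have k0 : 0 < 1 - normc z by rewrite subr_gt0.
have B0 : 0 <= B by have := bB 0%N; rewrite big_ord0.
have n0 x : 0 <= normc x by case: x => ? ?; exact: sqrtr_ge0.
set K := _ / _; elim=> [|N IH].
  by rewrite big_ord0 divr_ge0 ?(ltW k0)// addr_ge0.
rewrite big_ord_recl/= -[leRHS](_ : normc (a 0%N) + (normc z * K + B) = K); last first.
  by rewrite /K; field; rewrite gt_eqF.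
rewrite lerD2l; apply: (le_trans (y := \sum_(i < N) (normc z * normc (a i) + normc (b i)))).
  apply: ler_sum => i _; rewrite /bump/= add1n ab.
  by apply: le_trans (le_normcD _ _) _; rewrite ComplexField.Normc.normcM.
rewrite big_split/= -mulr_sumr; apply: lerD; last exact: bB.
exact: ler_wpM2l.
Qed.

(** Removing the factor X - z from the annihilating polynomial replaces the
    sequence [a k = L ^+ k V] by [a k.+1 - z a k], to which the induction
    hypothesis applies. *)
Lemma bounded_sum_annihilated n (L : 'M[C]_n.+1) (s : seq C) :
  (forall z, z \in s -> normc z < 1) ->
  forall V : 'M[C]_n.+1, horner_mx L (\prod_(z <- s) ('X - z%:P)) *m V = 0 ->
  forall i j, exists B, forall N, \sum_(k < N) normc ((L ^+ k *m V) i j) <= B.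
Proof.
elim: s => [|z s IH] s1 V.
  rewrite big_nil rmorph1 mul1mx => -> i j; exists 0 => N.
  by rewrite big1// => k _; rewrite mulmx0 mxE ComplexField.Normc.normc0.
rewrite big_cons mulrC rmorphM/= -mulmxE -mulmxA => sV i j.
have {}IH := IH (fun y ys => s1 y (mem_behead (s := z :: s) ys)) _ sV i j.
have [B hB] := IH.
pose a k := (L ^+ k *m V) i j.
exists ((normc (a 0%N) + B) / (1 - normc z)).
apply: (bounded_sum_recurrence (a := a)
  (b := fun k => (L ^+ k *m (horner_mx L ('X - z%:P) *m V)) i j) _ _ hB).
  by apply: s1; rewrite mem_head.
move=> k; rewrite /a rmorphB/= horner_mx_X horner_mx_C exprSr -mulmxE.
rewrite mulmxBl mulmxBr mul_scalar_mx -scalemxAr -mulmxA.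
have e (U U' : 'M[C]_n.+1) : U i j = z * U' i j + (U - z *: U') i j.
  by rewrite !mxE; ring.
exact: e.
Qed.

Lemma normc_real (x : R) : normc (x%:C)%C = `|x|.
Proof. by rewrite /ComplexField.Normc.normc/= expr0n/= addr0 sqrtr_sqr. Qed.

(** The supremum bounds its set because the eigenvalues are the finitely many
    roots of the characteristic polynomial. *)
Lemma eigenvalue_le_spectral_radius n (L : 'M[R]_n) (z : C) :
  eigenvalue (map_mx (real_complex R) L) z -> normc z <= spectral_radius L.
Proof.
move=> ez; apply: ub_le_sup; last by exists z.
have [r Er] := closed_field_poly_normal (char_poly (map_mx (real_complex R) L)).
have n0 x : 0 <= normc x by case: x => ? ?; exact: sqrtr_ge0.
exists (\sum_(y <- r) normc y) => _ [y /= ey <-].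
have yr : y \in r.
  move: ey; rewrite eigenvalue_root_char Er rootZ ?root_prod_XsubC//.
  by rewrite lead_coef_eq0 -size_poly_eq0 size_char_poly.
by rewrite (big_rem y)//= lerDl sumr_ge0.
Qed.

Lemma spectral_radius_lt1_bounded_sum n (L : 'M[R]_n) : spectral_radius L < 1 ->
  exists B, forall i j N, \sum_(k < N) `|(L ^+ k) i j| <= B.
Proof.
case: n L => [|n] L rL; first by exists 0 => -[].
pose Lc := map_mx (real_complex R) L.
suff h : forall i j, exists B, forall N, \sum_(k < N) `|(L ^+ k) i j| <= B.
  have [B hB] := choice (fun ij : 'I_n.+1 * 'I_n.+1 => h ij.1 ij.2).
  have B0 ij : 0 <= B ij by have := hB ij 0%N; rewrite big_ord0.
  exists (\sum_ij B ij) => i j N; apply: (le_trans (hB (i, j) N)).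
  by rewrite (bigD1 (i, j))//= lerDl sumr_ge0.
move=> i j; have [r Er] := closed_field_poly_normal (char_poly Lc).
have {Er} Er : char_poly Lc = \prod_(z <- r) ('X - z%:P).
  by rewrite Er (monicP (char_poly_monic Lc)) scale1r.
have r1 z : z \in r -> normc z < 1.
  move=> zr; apply: le_lt_trans rL; apply: eigenvalue_le_spectral_radius.
  by rewrite eigenvalue_root_char Er root_prod_XsubC.
have CH : horner_mx Lc (\prod_(z <- r) ('X - z%:P)) *m 1%:M = 0.
  by rewrite -Er Cayley_Hamilton mul0mx.
have [B hB] := bounded_sum_annihilated r1 CH i j.
exists B => N; apply: le_trans (hB N); rewrite le_eqVlt; apply/orP; left; apply/eqP.
apply: eq_bigr => k _.
by rewrite mulmx1 /Lc -rmorphXn mxE normc_real.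
Qed.

End PowersSummable.

(** * Lyapunov recursions *)

Section Lyapunov.
Context {R : realType} {n : nat}.
Variables (G V0 V : 'M[R]_n).

Fixpoint lyapunov (k : nat) : 'M[R]_n :=
  if k is k'.+1 then G *m lyapunov k' *m G^T + V else V0.

(** The powers are those of [G^T], whose spectral radius is the one that is
    controlled. *)
Lemma lyapunovE k : lyapunov k =
  (G^T ^+ k)^T *m V0 *m (G^T ^+ k) +
  \sum_(j < k) (G^T ^+ j)^T *m V *m (G^T ^+ j).
Proof.
have expS j (U : 'M[R]_n) : G *m ((G^T ^+ j)^T *m U *m (G^T ^+ j)) *m G^T =
    (G^T ^+ j.+1)^T *m U *m (G^T ^+ j.+1).
  by rewrite exprSr -mulmxE trmx_mul trmxK !mulmxA.
elim: k => [|k IH] /=.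
  by rewrite big_ord0 addr0 expr0 trmx1 mul1mx mulmx1.
rewrite IH mulmxDr mulmxDl expS mulmx_sumr mulmx_suml -addrA; congr (_ + _).
rewrite (eq_bigr _ (fun (j : 'I_k) _ => expS j V)).
by rewrite big_ord_recl/= expr0 trmx1 mul1mx mulmx1 addrC.
Qed.

Lemma congr_entry_le (L U : 'M[R]_n) (B : R) i l :
  (forall a b, `|L a b| <= B) ->
  `|(L^T *m U *m L) i l| <= \sum_a \sum_b `|U b a| * B * `|L b i|.
Proof.
move=> LB; rewrite mxE; apply: le_trans (ler_norm_sum _ _ _) _.
apply: ler_sum => a _; rewrite normrM mxE.
apply: (le_trans (ler_wpM2r _ (ler_norm_sum _ _ _))) => //.
rewrite mulr_suml; apply: ler_sum => b _; rewrite mxE normrM.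
rewrite [leLHS](_ : _ = `|U b a| * `|L b i| * `|L a l|); last by ring.
by rewrite mulrAC ler_wpM2r// ler_wpM2l.
Qed.

(** One factor of each term is bounded by [B], and the other one is summed. *)
Lemma lyapunov_bounded (B : R) :
  (forall i j N, \sum_(k < N) `|(G^T ^+ k) i j| <= B) ->
  exists D, forall k i j, `|lyapunov k i j| <= D.
Proof.
move=> sumB.
have LB k a b : `|(G^T ^+ k) a b| <= B.
  apply: le_trans (sumB a b k.+1); rewrite big_ord_recr/= lerDr.
  by rewrite sumr_ge0.
have B0 (a : 'I_n) : 0 <= B by apply: le_trans (LB 0%N a a).
exists (\sum_a \sum_b `|V0 b a| * B * B + \sum_a \sum_b `|V b a| * B * B) => k i l.
rewrite lyapunovE mxE summxE; apply: le_trans (ler_normD _ _) _; apply: lerD.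
  apply: le_trans (congr_entry_le _ _ _ (LB k)) _.
  apply: ler_sum => a _; apply: ler_sum => b _.
  by rewrite ler_wpM2l// mulr_ge0 ?(B0 i).
apply: le_trans (ler_norm_sum _ _ _) _.
apply: le_trans (ler_sum _ (fun (j : 'I_k) _ => congr_entry_le V i l (LB j))) _.
rewrite exchange_big/=; apply: ler_sum => a _.
rewrite exchange_big/=; apply: ler_sum => b _.
by rewrite -mulr_sumr ler_wpM2l ?sumB// mulr_ge0 ?(B0 i).
Qed.

Lemma det_bounded (A : nat -> 'M[R]_n) (D : R) :
  (forall k i j, `|A k i j| <= D) -> exists E, forall k, \det (A k) <= E.
Proof.
move=> AD; exists (\sum_(s : 'S_n) D ^+ n) => k.
apply: le_trans (ler_norm _) _; rewrite /determinant.
apply: le_trans (ler_norm_sum _ _ _) _; apply: ler_sum => s _.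
rewrite normrM normrX normrN1 expr1n mul1r normr_prod.
rewrite -[in leRHS](card_ord n) -prodr_const; apply: ler_prod => i _.
by rewrite normr_ge0 AD.
Qed.

Lemma mulmx_bounded (A : nat -> 'M[R]_n) (U : 'M[R]_n) (D : R) :
  (forall k i j, `|A k i j| <= D) ->
  exists E, forall k i j, `|(1%:M + A k *m U) i j| <= E.
Proof.
move=> AD; exists (1 + \sum_a \sum_b D * `|U a b|) => k i j.
rewrite mxE; apply: le_trans (ler_normD _ _) _; apply: lerD.
  by rewrite mxE; case: eqP; rewrite ?normr1 ?normr0.
rewrite mxE; apply: le_trans (ler_norm_sum _ _ _) _; apply: ler_sum => a _.
have D0 b : 0 <= D * `|U a b| by rewrite mulr_ge0// (le_trans _ (AD 0%N i a)).
rewrite normrM (bigD1 j)//=; apply: (le_trans (ler_wpM2r _ (AD k i a))) => //.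
by rewrite lerDl sumr_ge0.
Qed.

End Lyapunov.

(** * The exponential moment of the quadratic cost *)

Section TiltedProcess.
Context {R : realType} {disp : measure_display} {T : measurableType disp}.
Variable P : probability T R.
Context {m : nat}.
(** The recursion [xS] and the Riccati equation [pE] are all that is kept of
    the control problem. *)
Variables (F p mu W X0 : 'M[R]_m) (x w : nat -> T -> 'cV[R]_m).
Hypotheses (pp : possemidefmx p) (pmu : possemidefmx mu)
  (pW : posdefmx W) (pWp : posdefmx (invmx W - p))
  (pX0 : posdefmx X0) (pX0p : posdefmx (invmx X0 - p)).
Let Wh := invmx (invmx W - p).
Hypothesis pE : p = mu + F^T *m (p + p *m Wh *m p) *m F.
Hypothesis xS : forall t o, x t.+1 o = F *m x t o + w t o.
Hypothesis gx0 : gaussian_vector P (x 0%N) X0.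
Hypothesis gw : forall t, gaussian_vector P (w t) W.
Hypothesis indep : mutually_independent P (noise_family (x 0%N) w).

Let G := (1%:M + Wh *m p) *m F.

Definition tilted_cov : nat -> 'M[R]_m :=
  lyapunov G (invmx (invmx X0 - p)) Wh.

Let tilted_prec k := invmx (tilted_cov k).
Let delta := \det (1%:M - p *m W).
(** Chosen so that [norm_const 0] is [sqrt (det (invmx X0))], the constant of
    an unweighted Gaussian vector, and so that [norm_const_step] holds. *)
Let norm_const k := Num.sqrt (\det (invmx X0) / \det (invmx X0 - p)) *
  Num.sqrt (\det (tilted_prec k) / delta ^+ k).

Lemma tilted_cov_posdef k : posdefmx (tilted_cov k).
Proof.
elim: k => [|k IH]; first exact: posdef_inv.
by have := posdef_next_tilted_cov F pWp erefl (posdef_inv IH); rewrite invmxK.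
Qed.

Lemma posdef_tilted_prec k : posdefmx (tilted_prec k).
Proof. exact/posdef_inv/tilted_cov_posdef. Qed.

Lemma det_tilt_gt0 : 0 < delta.
Proof.
rewrite /delta -[X in X - _](mulVmx (posdef_unit pW)) -mulmxBl det_mulmx.
by rewrite mulr_gt0 ?posdef_det_gt0.
Qed.

Lemma norm_const_ge0 k : 0 <= norm_const k. Proof. by rewrite mulr_ge0 ?sqrtr_ge0. Qed.

Lemma measurable_dotv_state k u : measurable_fun setT (fun o => dotv u (x k o)).
Proof.
elim: k u => [|k IH] u; first by apply: measurable_dotv_comp; case: gx0.
rewrite (_ : (fun _ => _) = (fun o => dotv (F^T *m u) (x k o) + dotv u (w k o))).
  by apply: measurable_funD => //; apply: measurable_dotv_comp; case: (gw k).
by apply/funext => o; rewrite xS /dotv mulmxDr mxE trmx_mul trmxK mulmxA.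
Qed.

Lemma measurable_quad_state k (M : 'M[R]_m) : possemidefmx M ->
  measurable_fun setT (fun o => quad M (x k o)).
Proof.
move=> /psd_sum_rank1[fs ->].
rewrite (_ : (fun _ => _) = (fun o => \sum_(f <- fs) dotv f (x k o) ^+ 2)).
  apply: measurable_sum => f; apply: measurable_funX.
  exact: measurable_dotv_state.
apply/funext => o; elim: fs => [|f fs IH].
  by rewrite !big_nil /quad mulmx0 mul0mx mxE.
by rewrite !big_cons quadD quad_rank1 IH.
Qed.

(** The future noise is part of the weight, with arbitrary frequencies [us]:
    this is how its independence of the past enters the induction. *)
Let weight N k (us : nat -> 'cV[R]_m) o : R :=
  expR (\sum_(t < k) quad mu (x t o) / 2) *
  expR (\sum_(k <= t < N) dotv (us t) (w t o)).

Lemma measurable_weight N k us : measurable_fun setT (weight N k us).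
Proof.
apply: measurable_funM; apply: measurableT_comp => //.
  apply: measurable_sum => t; apply: measurable_funM => //.
  exact: measurable_quad_state.
apply: measurable_sum => t; apply: measurable_dotv_comp; by case: (gw t).
Qed.

Lemma weight_ge0 N k us o : 0 <= weight N k us o.
Proof. by rewrite mulr_ge0 ?expR_ge0. Qed.

Lemma weight_precision k :
  tilted_prec k + p - mu = tilted_prec k + F^T *m (p + p *m Wh *m p) *m F.
Proof. by rewrite -addrA; congr (_ + _); rewrite {1}pE addrAC subrr add0r. Qed.

Lemma posdef_weight_precision k : posdefmx (tilted_prec k + p - mu).
Proof.
by rewrite weight_precision; exact: (posdef_weighted_prec F pp pWp erefl (posdef_tilted_prec k)).
Qed.

Lemma norm_const_step k : norm_const k / Num.sqrt (\det (tilted_prec k + p - mu)) =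
  norm_const k.+1 / Num.sqrt (\det (tilted_prec k.+1 + p)).
Proof.
have d0 := det_tilt_gt0.
have h := det_precision_step F pp pW pWp erefl (posdef_tilted_prec k).
have pS := posdef_det_gt0 (posdef_weight_precision k).
have pY : 0 < \det (tilted_prec k.+1 + p).
  by apply/posdef_det_gt0/posdefD => //; exact: posdef_tilted_prec.
have pP j : 0 < \det (tilted_prec j) by exact/posdef_det_gt0/posdef_tilted_prec.
have {}h : \det (tilted_prec k.+1) * \det (tilted_prec k + p - mu) =
    \det (tilted_prec k.+1 + p) * (delta * \det (tilted_prec k)).
  by rewrite weight_precision; move: h; rewrite invmxK.
rewrite /norm_const -!mulrA; congr (_ * _).
rewrite -!sqrtrV ?ltW// -!sqrtrM ?divr_ge0 ?exprn_ge0 ?ltW//; congr Num.sqrt.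
apply: (mulIf (x := \det (tilted_prec k + p - mu) *
  \det (tilted_prec k.+1 + p) * delta ^+ k.+1)).
  by rewrite !mulf_neq0 ?expf_neq0 ?gt_eqF.
rewrite [RHS](_ : _ = \det (tilted_prec k.+1) * \det (tilted_prec k + p - mu)); last first.
  by field; rewrite !gt_eqF ?exprn_gt0.
rewrite h exprS; field; by rewrite !gt_eqF ?exprn_gt0.
Qed.

(** The cost of time [k] subtracts [mu] from the precision; the noise [w k] is
    then absorbed by choosing for its frequency the one at which the next
    state is tested. *)
Lemma state_weighted N k us : (k <= N)%N ->
  gaussian_weighted P (weight N k us) (x k)
    (norm_const k * expR (\sum_(k <= t < N) quad W (us t) / 2)) (tilted_prec k + p).
Proof.
elim: k us => [|k IH] us kN.
  move=> u.
  pose v (t : nat) := if t is t'.+1 then us t' else u.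
  pose e (t : nat) := expR (quad (if t is t'.+1 then W else X0) (v t) / 2).
  have gn i : gaussian_vector P (noise_family (x 0%N) w i)
      (if i is i'.+1 then W else X0) by case: i.
  have ei i : (\int[P]_o (expR (dotv (v i) (noise_family (x 0%N) w i o)))%:E
      = (e i)%:E)%E.
    have Sge0 : 0 <= quad (if i is i'.+1 then W else X0) (v i).
      by case: i => [|i]; [case: (posdef_psd pX0)|case: (posdef_psd pW)].
    exact: (gaussian_mgf (gn i) Sge0).
  have := @independent_integral_prod R _ T P m (noise_family (x 0%N) w)
    (fun t y => expR (dotv (v t) y)) e N.+1 (fun i => (gn i).1) indep
    (fun i => measurableT_comp (@measurable_expR R) (measurable_dotv (v i)))
    (fun i y => expR_ge0 _) (fun i => expR_ge0 _) ei.
  rewrite big_ord_recl/= => h.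
  transitivity ((expR (quad X0 u / 2) * \prod_(i < N) expR (quad W (us i) / 2))%:E).
    rewrite -h; apply: eq_integral => o _; congr EFin.
    rewrite big_ord_recl/= /weight big_ord0 expR0 mul1r mulrC big_mkord.
    by rewrite expR_sum.
  congr EFin; rewrite big_mkord expR_sum.
  have -> : tilted_prec 0%N = invmx X0 - p by rewrite /tilted_prec/= invmxK.
  rewrite subrK invmxK [RHS]mulrC; congr (_ * _).
  have p1 : 0 < \det (invmx X0) by exact/posdef_det_gt0/posdef_inv.
  have p2 : 0 < \det (invmx X0 - p) by exact: posdef_det_gt0.
  rewrite /norm_const/= /tilted_prec/= invmxK expr0 divr1 -sqrtrM ?divr_ge0 ?(ltW p1) ?(ltW p2)//.
  by rewrite divfK ?gt_eqF// mulrAC mulfV ?mul1r// gt_eqF// sqrtr_gt0.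
move=> u.
pose us' t := if t == k then u else us t.
have big_us' (f : nat -> 'cV[R]_m -> R) :
    \sum_(k <= t < N) f t (us' t) = f k u + \sum_(k.+1 <= t < N) f t (us t).
  rewrite big_ltn// /us' eqxx; congr (_ + _); apply: eq_big_nat => t /andP[kt _].
  by rewrite gtn_eqF.
have pYmu := posdef_weight_precision k.
have cW0 : 0 <= norm_const k * expR (\sum_(k <= t < N) quad W (us' t) / 2).
  by rewrite mulr_ge0 ?norm_const_ge0 ?expR_ge0.
have := gaussian_weighted_tilt (@measurable_weight N k us') (@weight_ge0 N k us') cW0
  (fun u => measurable_dotv_state k u) pmu pYmu (IH us' (ltnW kN)).
move=> /(_ (F^T *m u)) h.
transitivity (\int[P]_o (weight N k us' o * expR (quad mu (x k o) / 2) *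
    expR (dotv (F^T *m u) (x k o)))%:E)%E.
  apply: eq_integral => o _; congr EFin; rewrite /weight -!expRD; congr expR.
  rewrite big_ord_recr/= (big_us' (fun t v => dotv v (w t o))) xS.
  have -> : dotv u (F *m x k o + w k o) = dotv (F^T *m u) (x k o) + dotv u (w k o).
    by rewrite /dotv mulmxDr mxE trmx_mul trmxK mulmxA.
  ring.
rewrite h; congr EFin.
rewrite (big_us' (fun t v => quad W v / 2)).
rewrite [norm_const k * _ / _]mulrAC norm_const_step.
have -> : quad (invmx (tilted_prec k.+1 + p)) u =
    quad W u + quad (invmx (tilted_prec k + p - mu)) (F^T *m u).
  have := precision_step F pp pW pWp erefl (posdef_tilted_prec k); rewrite invmxK => h1.
  have -> : tilted_prec k.+1 + p = invmx (F *m invmx (tilted_prec k + p - mu) *m F^T + W).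
    by rewrite weight_precision h1.
  by rewrite invmxK quadD addrC -quad_congr trmxK.
by rewrite mulrDl !expRD; ring.
Qed.

(** The last state is tested at frequency 0. *)
Lemma expectation_quadratic N :
  (\int[P]_o (expR (\sum_(t < N) quad mu (x t o) / 2))%:E =
   (Num.sqrt (\det (invmx X0) / \det (invmx X0 - p) / delta ^+ N /
      \det (1%:M + tilted_cov N *m p)))%:E)%E.
Proof.
have := @state_weighted N N (fun=> 0) (leqnn N) 0.
rewrite !quad0 !mul0r big_geq// !expR0 !mulr1 => h.
transitivity (\int[P]_o (weight N N (fun=> 0) o * expR (dotv 0 (x N o)))%:E)%E.
  apply: eq_integral => o _; congr EFin; rewrite /weight big_geq// expR0 mulr1.
  by rewrite /dotv trmx0 mul0mx mxE expR0 mulr1.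
rewrite h; congr EFin; have d0 := det_tilt_gt0.
have pY : 0 < \det (tilted_prec N + p).
  by apply/posdef_det_gt0/posdefD => //; exact: posdef_tilted_prec.
have pP : 0 < \det (tilted_prec N) by exact/posdef_det_gt0/posdef_tilted_prec.
have uS := posdef_unit (tilted_cov_posdef N).
have E : \det (tilted_prec N) * \det (1%:M + tilted_cov N *m p) = \det (tilted_prec N + p).
  by rewrite -det_mulmx mulmxDr mulmx1 mulmxA mulVmx// mul1mx.
have pD : 0 < \det (1%:M + tilted_cov N *m p) by rewrite -(pmulr_rgt0 _ pP) E.
have p1 : 0 < \det (invmx X0) by exact/posdef_det_gt0/posdef_inv.
have p2 : 0 < \det (invmx X0 - p) by exact: posdef_det_gt0.
rewrite /norm_const -E -!sqrtrV ?mulr_ge0 ?ltW// -!sqrtrM ?mulr_ge0 ?invr_ge0 ?exprn_ge0 ?ltW//.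
by congr Num.sqrt; field; rewrite !gt_eqF ?exprn_gt0.
Qed.

(** [det (1 + S p) det S^-1 = det (S^-1 + p)], and adding [p] does not lower
    the determinant. *)
Lemma det_tilted_cov_ge1 N : 1 <= \det (1%:M + tilted_cov N *m p).
Proof.
have pP : 0 < \det (tilted_prec N) by exact/posdef_det_gt0/posdef_tilted_prec.
have uS := posdef_unit (tilted_cov_posdef N).
rewrite -(ler_pM2l pP) mulr1 -det_mulmx mulmxDr mulmx1 mulmxA mulVmx// mul1mx.
by apply: det_add_psd_ge => //; exact: posdef_tilted_prec.
Qed.

Lemma det_tilted_cov_bounded : spectral_radius G^T < 1 ->
  exists E, forall N, \det (1%:M + tilted_cov N *m p) <= E.
Proof.
move=> /spectral_radius_lt1_bounded_sum[B hB].
have [D hD] := lyapunov_bounded (invmx (invmx X0 - p)) Wh hB.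
have [E hE] := mulmx_bounded p hD.
exact: det_bounded hE.
Qed.

End TiltedProcess.

(** * The long-run cost *)

Section LinearGrowth.
Context {R : realType}.

Lemma cvg_linear_rate (g : nat -> R) (C l : R) :
  (forall n, `|g n| <= C) ->
  n%:R^-1 * (g n + n%:R * l) @[n --> \oo] --> l.
Proof.
move=> gC; rewrite -cvg_shiftS.
have -> : [sequence n.+1%:R^-1 * (g n.+1 + n.+1%:R * l)]_n =
    (fun n => l + n.+1%:R^-1 * g n.+1).
  by apply/funext => n; rewrite /= mulrDr mulKf// addrC.
rewrite -[in X in _ --> X](addr0 l); apply: cvgD; first exact: cvg_cst.
have hC : C * @harmonic R n @[n --> \oo] --> (0 : R).
  by rewrite -[0 in X in _ --> X](mulr0 C); apply: cvgMr => //; exact: cvg_harmonic.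
have hNC : - (C * @harmonic R n) @[n --> \oo] --> (0 : R).
  by rewrite -oppr0; exact: cvgN.
apply: squeeze_cvgr hNC hC; near=> n.
rewrite /= -ler_norml normrM ger0_norm// mulrC.
by rewrite ler_wpM2r.
Unshelve. all: by end_near. Qed.

End LinearGrowth.

Section RiskSensitiveRiccati.
Context {R : realType} {m d : nat}.
Variables (A : 'M[R]_m) (B : 'M[R]_(m, d)) (Q : 'M[R]_m) (Rc : 'M[R]_d).
Variables (W : 'M[R]_m) (beta : R) (K : 'M[R]_(d, m)) (PK : 'M[R]_m).
Hypotheses (hbeta : 0 < beta) (hW : posdefmx W)
  (hWP : posdefmx (invmx W - beta *: PK)).
Let Wh := invmx (invmx W - beta *: PK).
Let F := A - B *m K.

(** Factoring [- beta^-1] out of the inverted matrix of the Riccati equation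
    replaces it by the inverse of [invmx W - beta PK]. *)
Lemma riccati_scaled : riccati_equation A B Q Rc W beta K PK ->
  beta *: PK = beta *: (Q + K^T *m Rc *m K) +
    F^T *m (beta *: PK + beta *: PK *m Wh *m (beta *: PK)) *m F.
Proof.
move=> hric; rewrite {1}hric scalerDr; congr (_ + _).
have b0 : beta != 0 by rewrite gt_eqF.
have uY := posdef_unit hWP.
have e : - (beta^-1 *: invmx W) + PK = (- beta^-1) *: (invmx W - beta *: PK).
  by rewrite scalerBr scalerA mulNr mulVf// !scaleNr scale1r opprK.
rewrite e invmxZ; last by rewrite unitmxZ// unitfE oppr_eq0 invr_eq0.
rewrite scalemxAl scalemxAr; congr (_ *m _ *m _).
rewrite -/Wh -?scalemxAr -?scalemxAl -?scalemxAr -?scalemxAl.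
by rewrite invrN invrK scaleNr opprK scalerDr.
Qed.

(** The inverse of [1 - p W] is [1 + p Wh], so the matrix of the stabilizing
    hypothesis is the transpose of the closed loop under the reweighted law. *)
Lemma tilted_closed_loop : possemidefmx PK ->
  ((1%:M + Wh *m (beta *: PK)) *m F)^T =
  F^T *m invmx (1%:M - beta *: (PK *m W)).
Proof.
move=> [sP _]; have [sWh _] := posdef_inv hWP.
have t : (1%:M + beta *: PK *m Wh) *m (1%:M - beta *: PK *m W) = 1%:M.
  exact: tilt_mulr.
have u : 1%:M - beta *: PK *m W \in unitmx by have [] := mulmx1_unit t.
rewrite trmx_mul [(1%:M + _)^T]linearD/= trmx1 trmx_mul sWh.
rewrite [(beta *: PK)^T]linearZ/= sP; congr (_ *m _).
by rewrite -/Wh scalemxAl -[RHS]mul1mx -[X in _ = X *m _]t -mulmxA mulmxV ?mulmx1.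
Qed.

End RiskSensitiveRiccati.

(* The hypothesis hX0P is not in the source. It is the condition under which
   E exp[(beta/2) x_0^T P_K x_0] is finite; it cannot be dropped. For instance
   with A = B = K = 0 one has P_K = Q, and J(K) = +oo as soon as
   X0^-1 - beta Q is not positive definite. *)
Theorem lemma2p1 (R : realType) (disp : measure_display)
    (T : measurableType disp) (P : probability T R) (m d : nat)
    (A : 'M[R]_m) (B : 'M[R]_(m, d)) (Q : 'M[R]_m) (Rc : 'M[R]_d)
    (X0 W : 'M[R]_m) (beta : R)
    (x0 : T -> 'cV[R]_m) (w : nat -> T -> 'cV[R]_m)
    (hQ : posdefmx Q) (hR : posdefmx Rc)
    (hX0 : posdefmx X0) (hW : posdefmx W) (hbeta : 0 < beta)
    (hx0 : gaussian_vector P x0 X0)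
    (hw : forall t : nat, gaussian_vector P (w t) W)
    (hindep : mutually_independent P (noise_family x0 w))
    (K : 'M[R]_(d, m))
    (hK : spectral_radius (A - B *m K) < 1)
    (PK : 'M[R]_m)
    (hric : riccati_equation A B Q Rc W beta K PK)
    (hPK : possemidefmx PK)
    (hstab : spectral_radius
       ((A - B *m K)^T *m invmx (1%:M - beta *: (PK *m W))) < 1)
    (hWP : posdefmx (invmx W - beta *: PK))
    (hX0P : posdefmx (invmx X0 - beta *: PK)) :
  cvgn (finite_horizon_cost P A B Q Rc beta x0 w K) /\
  leqg_cost P A B Q Rc beta x0 w K
    = (- beta^-1 * ln (\det (1%:M - beta *: (PK *m W))))%:E.
Proof.
have pP : possemidefmx (beta *: PK) by apply: psdZ => //; exact: ltW.
pose F := A - B *m K.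
pose M := Q + K^T *m Rc *m K.
have pM : possemidefmx (beta *: M).
  by apply: psdZ; [exact: ltW | apply: psdD; [|apply: psd_congr]; exact: posdef_psd].
pose x := state A B K x0 w.
have xS t o : x t.+1 o = F *m x t o + w t o.
  by rewrite /x/= mulmxN mulmxA /F mulmxBl.
have pE := riccati_scaled hbeta hWP hric.
have E N := expectation_quadratic pP pM hW hWP hX0 hX0P pE xS hx0 hw hindep N.
rewrite -(tilted_closed_loop A B K hW hWP hPK) in hstab.
have [Dmax hDmax] := det_tilted_cov_bounded X0 hstab.
have D1 := det_tilted_cov_ge1 F pP hWP hX0P.
have delta0 := det_tilt_gt0 hW hWP.
set D := fun N => \det (1%:M + tilted_cov F (beta *: PK) W X0 N *m (beta *: PK)) in D1.
have {}hDmax N : D N <= Dmax by exact: hDmax.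
have {}E N : (\int[P]_o (expR (\sum_(t < N) quad (beta *: M) (x t o) / 2))%:E)%E =
  (Num.sqrt (\det (invmx X0) / \det (invmx X0 - beta *: PK) /
     \det (1%:M - beta *: PK *m W) ^+ N / D N))%:E by exact: E.
have p1 : 0 < \det (invmx X0) by exact/posdef_det_gt0/posdef_inv.
have p2 : 0 < \det (invmx X0 - beta *: PK) by exact: posdef_det_gt0.
rewrite scalemxAl; set delta := \det (1%:M - beta *: PK *m W) in E delta0 *.
set kappa := _ / _ in E.
have kappa0 : 0 < kappa by rewrite divr_gt0.
have D0 N : 0 < D N by exact: lt_le_trans (D1 N).
have costE N : finite_horizon_cost P A B Q Rc beta x0 w K N =
  (N%:R^-1 * (beta^-1 * (ln kappa - ln (D N)) + N%:R * (- beta^-1 * ln delta)))%:E.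
  rewrite /finite_horizon_cost unlock.
  rewrite (_ : (\int[P]_o _)%E = (Num.sqrt (kappa / delta ^+ N / D N))%:E); last first.
    rewrite -E; apply: eq_integral => o _; congr (expR _)%:E.
    rewrite mulr_sumr; apply: eq_bigr => t _.
    rewrite /stage_cost /M quadZ quadD quad_congr -/(x t o).
    have -> : quad Rc (- (K *m x t o)) = quad Rc (K *m x t o).
      by rewrite -scaleN1r -[_ *: _]add0r quadDZ ?(proj1 hR)// quad0 /bilin mulmx0 mxE; ring.
    by ring.
  have q0 : 0 < kappa / delta ^+ N / D N by rewrite !divr_gt0 ?exprn_gt0.
  rewrite lne_EFin ?sqrtr_gt0// -EFinM; congr EFin.
  have -> : ln (Num.sqrt (kappa / delta ^+ N / D N)) =
      (ln kappa - ln delta *+ N - ln (D N)) / 2.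
    have s0 : 0 < Num.sqrt (kappa / delta ^+ N / D N) by rewrite sqrtr_gt0.
    rewrite -lnXn// -!ln_div ?posrE ?divr_gt0 ?exprn_gt0//.
    by rewrite -[in RHS](sqr_sqrtr (ltW q0)) lnXn// mulr2n; field.
  rewrite -mulr_natl -mulrA; congr (_ * _).
  by field; rewrite gt_eqF.
have cv : finite_horizon_cost P A B Q Rc beta x0 w K @ \oo --> (- beta^-1 * ln delta)%:E.
  rewrite (_ : finite_horizon_cost _ _ _ _ _ _ _ _ _ = EFin \o (fun N : nat =>
     N%:R^-1 * (beta^-1 * (ln kappa - ln (D N)) + N%:R * (- beta^-1 * ln delta)))); last first.
    by apply/funext => N; exact: costE.
  apply: cvg_EFin; first exact: nearW.
  apply: (cvg_linear_rate (C := beta^-1 * (`|ln kappa| + ln Dmax))) => N.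
  have bi0 : 0 <= beta^-1 by rewrite invr_ge0 ltW.
  rewrite normrM (ger0_norm bi0) ler_wpM2l//.
  apply: le_trans (ler_normB _ _) _; rewrite lerD2l ger0_norm; last exact/ln_ge0/D1.
  by rewrite ler_ln ?hDmax// posrE// (lt_le_trans (D0 N) (hDmax N)).
by split; [apply/cvg_ex; eexists; exact: cv | exact: cvg_lim cv].
Qed.
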